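(* Let $\mathbf F$ be a finite field, $k\in\mathbb N$, and let $\mathbf B$ be an $\mathbf R$-module such that $|F|$ is invertible in $\mathbf R$. Then the lattice of (non-empty) clonoids from $\mathbf F^k$ to $\mathbf B$ is isomorphic to $\prod_{i=0}^k\mathrm{Sub}(\mathbf M_{i,k}(\mathbf F,\mathbf B))$. Moreover, for $j\le k$, the sublattice $\prod_{i=0}^j\mathrm{Sub}(\mathbf M_{i,k}(\mathbf F,\mathbf B))$ (that is, the tuples whose components with index $i>j$ are the zero submodule) corresponds under this isomorphism to the clonoids consisting of functions that are generated by their $j$-ary minors.
   Context: $\mathbb N=\{1,2,\dots\}$. Rings are unital, modules are left modules; ''$|F|$ is invertible in $\mathbf R$'' means $|F|\cdot 1_{\mathbf R}$ is a unit. $\mathbf F^k$ is the $k$-dimensional vector space over $\mathbf F$; $(F^k)^m$ is identified with $F^{m\times k}$ (arguments are rows). A module over a ring $\mathbf S$ is viewed as an algebra whose $m$-ary term operations are the maps $\sum_{i=1}^ms_ix_i$, $s_i\in S$. A clonoid from $\mathbf F^k$ to $\mathbf B$ is a set $\mathcal C$ of finitary operations $f\colon (F^k)^m\to B$ ($m\ge1$) such that: (i) if $f_1,\dots,f_n\in\mathcal C$ are $m$-ary and $g$ is an $n$-ary term operation of $\mathbf B$, then $g\circ(f_1,\dots,f_n)\in\mathcal C$; (ii) if $f\in\mathcal C$ is $m$-ary and $g_1,\dots,g_m$ are $n$-ary term operations of $\mathbf F^k$, then $f\circ(g_1,\dots,g_m)\in\mathcal C$ (equivalently, $X\mapsto f(MX)$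 is in $\mathcal C$ for every $M\in F^{m\times n}$). Clonoids are ordered by inclusion and form a lattice; clonoids are taken non-empty, so each contains the zero functions. For $1\le i\le k$, $\mathbf M_{i,k}(\mathbf F,\mathbf B)$ is the module of all functions $f\colon\{X\in F^{i\times k}\mid\mathrm{rk}(X)=i\}\to B$ over the group ring $\mathbf R[\mathrm{GL}_i(\mathbf F)]$, acting by $\big(\sum_M\alpha_MM\big)f(X)=\sum_M\alpha_Mf(MX)$. Thus its submodules are the $\mathbf R$-submodules of functions closed under $f\mapsto f(M\,\cdot)$ for all $M\in\mathrm{GL}_i(\mathbf F)$. Further, $\mathbf M_{0,k}(\mathbf F,\mathbf B)=\mathbf B$ as an $\mathbf R$-module. $\mathrm{Sub}(\mathbf M)$ is the lattice of submodules of $\mathbf M$. An $m$-ary $f\colon F^{m\times k}\to B$ is generated by its $j$-ary minors if there are finitely many matrices $M_1,\dots,M_p\in F^{m\times m}$ of rank $\le j$ and $\alpha_1,\dots,\alpha_p\in R$ with $f(X)=\sum_{t=1}^p\alpha_tf(M_tX)$ for all $X$. *)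

(* Defs.v *)
From HB Require Import structures.
From mathcomp Require Import all_boot all_order all_algebra all_fingroup.
From mathcomp Require Import boolp classical_sets functions.

Set Implicit Arguments.
Unset Strict Implicit.
Unset Printing Implicit Defensive.

Import Order.TTheory GRing.Theory.

Local Open Scope ring_scope.

Notation lat_disp := (Order.Disp tt tt).

#[local] Obligation Tactic := idtac.

(* [pzRingType] also allows the zero ring and has no built-in units. *)
Definition invertible (R : pzRingType) (x : R) : Prop :=
  exists y : R, y * x = 1 /\ x * y = 1.

Definition term_op (S : pzRingType) (V : lmodType S) (m : nat)
    (g : ('I_m -> V) -> V) : Prop :=
  exists s : 'I_m -> S, forall x, g x = \sum_(i < m) s i *: x i.

Definition gen_by_minors (F : finFieldType) (R : pzRingType) (B : lmodType R)
    (k m j : nat) (f : 'M[F]_(m, k) -> B) : Prop :=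
  exists (p : nat) (M : 'I_p -> 'M[F]_m) (a : 'I_p -> R),
    (forall t, (\rank (M t) <= j)%N) /\
    (forall X, f X = \sum_(t < p) a t *: f (M t *m X)).

Section ClonoidDef.
Variables (F : finFieldType) (k : nat) (R : pzRingType) (B : lmodType R).

(* Arities are positive: [C m] is the set of the operations of arity m.+1 in C.
   The arguments of an operation are the rows of a matrix. *)
Unset Implicit Arguments.
Record clonoid := Clonoid {
  clonoid_ops :> forall m : nat, set ('M[F]_(m.+1, k) -> B);
  clonoid_nonempty : exists m f, clonoid_ops m f;
  clonoid_codom : forall (m n : nat) (f : 'I_n.+1 -> 'M[F]_(m.+1, k) -> B)
      (g : ('I_n.+1 -> B) -> B),
    (forall i, clonoid_ops m (f i)) -> term_op g ->
    clonoid_ops m (fun X => g (fun i => f i X));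
  clonoid_dom : forall (m n : nat) (f : 'M[F]_(m.+1, k) -> B)
      (g : 'I_m.+1 -> ('I_n.+1 -> 'rV[F]_k) -> 'rV[F]_k),
    clonoid_ops m f -> (forall i, term_op (g i)) ->
    clonoid_ops n (fun X => f (\matrix_i g i (fun l => row l X)))
}.
Set Implicit Arguments.

Definition clonoid_le (C D : clonoid) : bool :=
  `[< forall m, (C m `<=` D m)%classic >].

HB.instance Definition _ := gen_eqMixin clonoid.
HB.instance Definition _ := gen_choiceMixin clonoid.

Lemma clonoid_leP (C D : clonoid) :
  reflect (forall m f, C m f -> D m f) (clonoid_le C D).
Proof. exact: asboolP. Qed.

Lemma clonoid_eq (C D : clonoid) : (forall m f, C m f <-> D m f) -> C = D.
Proof.
case: C D => [C C0 C1 C2] [D D0 D1 D2] /= CD.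
have E : C = D by apply: functional_extensionality_dep => m; apply/funext => f; apply/propext.
by case: _ / E D0 D1 D2 => *; congr Clonoid; exact: Prop_irrelevance.
Qed.

Lemma clonoid0 (C : clonoid) m : C m (fun=> 0).
Proof.
have [n [f Cf]] := clonoid_nonempty C.
have Cf' : C m (fun X => f (\matrix_i 0)).
  apply: (clonoid_dom C n m f (fun=> fun=> 0)) => // i.
  by exists (fun=> 0) => x; rewrite big1 // => l _; rewrite scale0r.
apply: (clonoid_codom C m 0 (fun=> fun X => f (\matrix_i 0)) (fun=> 0)) => //.
by exists (fun=> 0) => x; rewrite big1 // => l _; rewrite scale0r.
Qed.

Lemma clonoid_le_refl : reflexive clonoid_le.
Proof. by move=> C; apply/clonoid_leP. Qed.

Lemma clonoid_le_anti : antisymmetric clonoid_le.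
Proof.
move=> C D /andP[/clonoid_leP CD /clonoid_leP DC].
by apply: clonoid_eq => m f; split; [exact: CD|exact: DC].
Qed.

Lemma clonoid_le_trans : transitive clonoid_le.
Proof.
move=> D C E /clonoid_leP CD /clonoid_leP DE.
by apply/clonoid_leP => m f /CD /DE.
Qed.

HB.instance Definition _ := Order.Le_isPOrder.Build lat_disp clonoid
  clonoid_le_refl clonoid_le_anti clonoid_le_trans.

Section Inter.
Variable P : clonoid -> Prop.

Definition clonoid_inter_ops m : set ('M[F]_(m.+1, k) -> B) :=
  fun f => forall E, P E -> E m f.

Program Definition clonoid_inter := @Clonoid clonoid_inter_ops _ _ _.
Next Obligation. by exists 0%N, (fun=> 0) => E _; exact: clonoid0. Qed.
Next Obligation.
by move=> m n f g Cf gt E PE; apply: clonoid_codom => // i; exact: Cf.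
Qed.
Next Obligation.
by move=> m n f g Cf gt E PE; apply: (clonoid_dom E m n f g) => //; exact: Cf.
Qed.

End Inter.

Definition clonoid_meet (C D : clonoid) := clonoid_inter (fun E => E = C \/ E = D).
Definition clonoid_join (C D : clonoid) :=
  clonoid_inter (fun E => clonoid_le C E /\ clonoid_le D E).

Lemma clonoid_meetP (C D E : clonoid) :
  clonoid_le C (clonoid_meet D E) = clonoid_le C D && clonoid_le C E.
Proof.
apply/clonoid_leP/andP => [H|[/clonoid_leP CD /clonoid_leP CE] m f Cf].
  by split; apply/clonoid_leP => m f /H; apply; [left|right].
by move=> _ [|] ->; [exact: CD|exact: CE].
Qed.

Lemma clonoid_joinP (C D E : clonoid) :
  clonoid_le (clonoid_join C D) E = clonoid_le C E && clonoid_le D E.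
Proof.
apply/clonoid_leP/andP => [H|[CE DE] m f]; last exact.
by split; apply/clonoid_leP => m f Cf; apply: H => G [/clonoid_leP CG /clonoid_leP DG];
  [exact: CG|exact: DG].
Qed.

HB.instance Definition _ := Order.POrder_MeetJoin_isLattice.Build lat_disp clonoid
  clonoid_meetP clonoid_joinP.

End ClonoidDef.

Arguments clonoid F k {R} B.
Arguments clonoid_ops {F k R B} c m f.
Arguments clonoid_nonempty {F k R B} c.
Arguments clonoid_codom {F k R B} c m n f g.
Arguments clonoid_dom {F k R B} c m n f g.

(* A module presented by its additive group, its set of scalars and the action
   of the scalars: exactly the data on which its lattice of submodules depends. *)
Record actModule := ActModule {
  am_carrier :> zmodType;
  am_scalar : Type;
  am_act : am_scalar -> am_carrier -> am_carrier
}.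

Section SubmoduleDef.
Variable M : actModule.

Record submodule := Submodule {
  submodule_set :> M -> Prop;
  submodule0 : submodule_set 0;
  submoduleB : forall x y, submodule_set x -> submodule_set y ->
    submodule_set (x - y);
  submodule_act : forall (s : am_scalar M) x, submodule_set x ->
    submodule_set (am_act s x)
}.

Definition submodule_le (U V : submodule) : bool := `[< (U `<=` V)%classic >].

HB.instance Definition _ := gen_eqMixin submodule.
HB.instance Definition _ := gen_choiceMixin submodule.

Lemma submodule_leP (U V : submodule) :
  reflect (forall x, U x -> V x) (submodule_le U V).
Proof. exact: asboolP. Qed.

Lemma submodule_eq (U V : submodule) : (forall x, U x <-> V x) -> U = V.
Proof.
case: U V => [U U0 U1 U2] [V V0 V1 V2] /= UV.
have E : U = V by apply/funext => x; apply/propext.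
by case: _ / E V0 V1 V2 => *; congr Submodule; exact: Prop_irrelevance.
Qed.

Lemma submodule_le_refl : reflexive submodule_le.
Proof. by move=> U; apply/submodule_leP. Qed.

Lemma submodule_le_anti : antisymmetric submodule_le.
Proof.
move=> U V /andP[/submodule_leP UV /submodule_leP VU].
by apply: submodule_eq => x; split; [exact: UV|exact: VU].
Qed.

Lemma submodule_le_trans : transitive submodule_le.
Proof.
move=> V U W /submodule_leP UV /submodule_leP VW.
by apply/submodule_leP => x /UV /VW.
Qed.

HB.instance Definition _ := Order.Le_isPOrder.Build lat_disp submodule
  submodule_le_refl submodule_le_anti submodule_le_trans.

Section Inter.
Variable P : submodule -> Prop.

Definition submodule_inter_set : set M := fun x => forall W, P W -> W x.

Program Definition submodule_inter := @Submodule submodule_inter_set _ _ _.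
Next Obligation. by move=> W _; exact: submodule0. Qed.
Next Obligation.
by move=> x y Ux Uy W PW; apply: submoduleB; [exact: Ux|exact: Uy].
Qed.
Next Obligation. by move=> s x Ux W PW; apply: submodule_act; exact: Ux. Qed.

End Inter.

Definition submodule_meet (U V : submodule) :=
  submodule_inter (fun W => W = U \/ W = V).
Definition submodule_join (U V : submodule) :=
  submodule_inter (fun W => submodule_le U W /\ submodule_le V W).

Lemma submodule_meetP (U V W : submodule) :
  submodule_le U (submodule_meet V W) = submodule_le U V && submodule_le U W.
Proof.
apply/submodule_leP/andP => [H|[/submodule_leP UV /submodule_leP UW] x Ux].
  by split; apply/submodule_leP => x /H; apply; [left|right].
by move=> _ [|] ->; [exact: UV|exact: UW].
Qed.

Lemma submodule_joinP (U V W : submodule) :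
  submodule_le (submodule_join U V) W = submodule_le U W && submodule_le V W.
Proof.
apply/submodule_leP/andP => [H|[UW VW] x]; last exact.
by split; apply/submodule_leP => x Ux; apply: H => G [/submodule_leP UG /submodule_leP VG];
  [exact: UG|exact: VG].
Qed.

HB.instance Definition _ := Order.POrder_MeetJoin_isLattice.Build lat_disp submodule
  submodule_meetP submodule_joinP.

Definition is_zero_submodule (U : submodule) : Prop := forall x, U x <-> x = 0.

End SubmoduleDef.

Section DepProduct.
Variables (I : Type) (L : I -> latticeType lat_disp).

Definition prod_lattice : Type := forall i, L i.

Definition prod_le (x y : prod_lattice) : bool :=
  `[< forall i, (x i <= y i)%O >].

HB.instance Definition _ := gen_eqMixin prod_lattice.
HB.instance Definition _ := gen_choiceMixin prod_lattice.

Lemma prod_leP (x y : prod_lattice) :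
  reflect (forall i, (x i <= y i)%O) (prod_le x y).
Proof. exact: asboolP. Qed.

Lemma prod_le_refl : reflexive prod_le.
Proof. by move=> x; apply/prod_leP. Qed.

Lemma prod_le_anti : antisymmetric prod_le.
Proof.
move=> x y /andP[/prod_leP xy /prod_leP yx].
by apply: functional_extensionality_dep => i; apply/le_anti; rewrite xy yx.
Qed.

Lemma prod_le_trans : transitive prod_le.
Proof.
move=> y x z /prod_leP xy /prod_leP yz.
by apply/prod_leP => i; exact: le_trans (xy i) (yz i).
Qed.

HB.instance Definition _ := Order.Le_isPOrder.Build lat_disp prod_lattice
  prod_le_refl prod_le_anti prod_le_trans.

Definition prod_meet (x y : prod_lattice) : prod_lattice :=
  fun i => (x i `&` y i)%O.
Definition prod_join (x y : prod_lattice) : prod_lattice :=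
  fun i => (x i `|` y i)%O.

Lemma prod_meetP (x y z : prod_lattice) :
  prod_le x (prod_meet y z) = prod_le x y && prod_le x z.
Proof.
apply/prod_leP/andP => [H|[/prod_leP xy /prod_leP xz] i].
  by split; apply/prod_leP => i; have := H i; rewrite lexI => /andP[].
by rewrite lexI xy xz.
Qed.

Lemma prod_joinP (x y z : prod_lattice) :
  prod_le (prod_join x y) z = prod_le x z && prod_le y z.
Proof.
apply/prod_leP/andP => [H|[/prod_leP xz /prod_leP yz] i].
  by split; apply/prod_leP => i; have := H i; rewrite leUx => /andP[].
by rewrite leUx xz yz.
Qed.

HB.instance Definition _ := Order.POrder_MeetJoin_isLattice.Build lat_disp
  prod_lattice prod_meetP prod_joinP.

End DepProduct.

Section FullRankModule.
Variables (F : finFieldType) (k : nat) (R : pzRingType) (B : lmodType R).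

Definition full_rank (i : nat) : Type := {X : 'M[F]_(i, k) | \rank X == i}.

Lemma rank_GLmul i (M : {'GL_i.+1[F]}) (X : full_rank i.+1) :
  \rank ((GLval M : 'M_i.+1) *m sval X) == i.+1.
Proof.
have uM : (GLval M : 'M_i.+1) \in unitmx by case: M.
by rewrite (eqmxMfull _) ?row_full_unit //; exact: (svalP X).
Qed.

Definition GLmul i (M : {'GL_i.+1[F]}) (X : full_rank i.+1) : full_rank i.+1 :=
  exist (fun Y : 'M[F]_(i.+1, k) => \rank Y == i.+1) _ (rank_GLmul M X).

(* Elements of the group ring R[GL] are written as coefficient families. With
   the formula below M.(N.f) = f(NM _), so strictly this is a left action of the
   group ring of the opposite group; the submodules are not affected. *)
Definition group_ring_act i (a : {ffun {'GL_i.+1[F]} -> R})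
    (f : full_rank i.+1 -> B) : full_rank i.+1 -> B :=
  fun X => \sum_(M : {'GL_i.+1[F]}) a M *: f (GLmul M X).

Definition Mmod (i : nat) : actModule :=
  if i is i'.+1 then @ActModule (full_rank i'.+1 -> B) _ (@group_ring_act i')
  else @ActModule B R (@GRing.scale R B).

Definition Msub (i : nat) : latticeType lat_disp := submodule (Mmod i).

End FullRankModule.

Arguments Mmod F k {R} B i.
Arguments Msub F k {R} B i.

(* Main.v *)
Require Import Defs.
From HB Require Import structures.
From mathcomp Require Import all_boot all_order all_algebra all_fingroup.
From mathcomp Require Import boolp functions.

Set Implicit Arguments.
Unset Strict Implicit.
Unset Printing Implicit Defensive.

Import Order.TTheory GRing.Theory.

Local Open Scope ring_scope.

#[local] Obligation Tactic := idtac.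

(** Write [q] for the order of [F]. For each [n] there is an integral combination
    [z_n] of [n x n] matrices, equal to [q^N] times the identity plus singular
    matrices, with [z_n X = 0] and [X z_n = 0] for every singular [X] (this is
    Kovacs' theorem on the monoid algebra of matrices, when [q] is invertible).
    It is built by induction on [n]: let [z = sum_A w_A A] be the combination for
    [n], and for [f(y, x)], with [x] the last [n] arguments, put
    [f'(y, x) = sum_A w_A f(y, A x)] and [f'_b(x) = f'(b x, x)]. Then
      [q^(n+N) f'(y, x) - sum_b sum_A w_A sum_u f'_b(A x + u (y - b x))]
    vanishes if the rows of [x] are dependent, because [z x = 0], and if [y = c x]:
    the terms with [b = c] cancel [f'], and for [d = c - b <> 0] the inner sum of
    [f'_b((A + u d) x)] over [u] depends on [A] only through the hyperplane [d = 0],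
    so it is killed by [z].

    Given the [z_n], a clonoid [C] is sent to the submodules of those functions
    on full rank matrices whose extension by zero is in [C]; conversely submodules
    [U_i] are sent to the operations [f] such that [z_i] applied to each [i]-ary
    minor of [f] restricts to an element of [U_i]. These are mutually inverse since
    modulo minors of smaller arity [z_i f] is [q^N f], and [z_i f] is supported on
    full rank matrices; in particular it is zero for [i > k]. *)

(** * Integral combinations of matrices that annihilate singular matrices *)

Section Annihilator.
Variable F : finFieldType.

(** The list stands for an element of the integral monoid ring of matrices; integer coefficients let
    it act on functions into any abelian group. *)
Definition minor_comb (V : zmodType) n k (s : seq (int * 'M[F]_n))
    (f : 'M[F]_(n, k) -> V) (X : 'M[F]_(n, k)) : V :=
  \sum_(p <- s) f (p.2 *m X) *~ p.1.

Lemma unit_rank_lt n (M : 'M[F]_n) : (\rank M < n)%N = (M \notin unitmx).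
Proof. by rewrite -row_free_unit /row_free ltn_neqAle rank_leq_row andbT. Qed.

(* Adding multiples of the row [d] to [A] only depends on the restriction of [A]
   to the hyperplane [d = 0], so the sum factors through a projection onto it. *)
Lemma minor_comb_rank1_shift (V : zmodType) n (s : seq (int * 'M[F]_n))
    (h : 'M[F]_n -> V) (d : 'rV[F]_n) :
  (forall (g : 'M[F]_n -> V) X, (\rank X < n)%N -> minor_comb s g X = 0) ->
  d != 0 -> \sum_(p <- s) (\sum_(u : 'cV[F]_n) h (p.2 + u *m d)) *~ p.1 = 0.
Proof.
move=> kill d0.
have /row_freeP[v dv1] : row_free d by rewrite /row_free rank_rV d0.
pose G A := \sum_(u : 'cV[F]_n) h (A + u *m d).
have pi_sing : (\rank (1%:M - v *m d)%R < n)%N.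
  rewrite unit_rank_lt; apply/negP => /mulKmx pK.
  have piv0 : (1%:M - v *m d) *m v = 0.
    by rewrite mulmxBl mul1mx -mulmxA dv1 mulmx1 subrr.
  have v0 : v = 0 by rewrite -[v]pK piv0 mulmx0.
  by move/eqP: dv1; rewrite v0 mulmx0 eq_sym oner_eq0.
rewrite -[RHS](kill G _ pi_sing); apply: eq_bigr => p _; congr (_ *~ _).
(* Shifting [u] by [- A v] turns [A + u d] into [A (1 - v d) + u d]. *)
rewrite /G (reindex_inj (addIr (- (p.2 *m v)))) /=.
by apply: eq_bigr => u _; rewrite mulmxBr mulmx1 mulmxBl mulmxA [in RHS]addrAC addrA.
Qed.

Section Step.
Variables (n : nat) (c0 : int) (s : seq (int * 'M[F]_n)).
Hypothesis s_sing : all (fun p => \rank p.2 < n)%N s.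
Let z := (c0, 1%:M) :: s.
Hypothesis z_kill : forall (V : zmodType) k (g : 'M[F]_(n, k) -> V) X,
  (\rank X < n)%N -> minor_comb z g X = 0.

Let D (A : 'M[F]_n) : 'M[F]_(1 + n) := block_mx 1%:M 0 0 A.
(** This sends the stacked (y, x) to (b w, w) with w = A x + u (y - b x), the argument at which f'
    is evaluated in f'_b. The factorization through [n] rows bounds its rank. *)
Let E (A : 'M[F]_n) (b : 'rV[F]_n) (u : 'cV[F]_n) : 'M[F]_(1 + n) :=
  col_mx b 1%:M *m row_mx u (A - u *m b).

(** The overview's expression, times [c0] in its first term, expanded into single matrices without
    the identity term: the first list comes from f', the second from the subtracted sum, where f' is
    again expanded over [z]. *)
Definition step_tail : seq (int * 'M[F]_(1 + n)) :=
  [seq (p.1 * (c0 *+ (#|F| ^ n)), D p.2) | p <- s] ++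
  [seq (- (pp.2.1 * pp.1.1), D pp.2.2 *m E pp.1.2 bu.1 bu.2) |
     pp <- [seq (p, p') | p <- z, p' <- z],
     bu <- enum {: 'rV[F]_n * 'cV[F]_n}].

Lemma step_tail_sing : all (fun p => \rank p.2 < 1 + n)%N step_tail.
Proof.
rewrite all_cat; apply/andP; split; apply/allP => p.
  case/mapP=> q qs ->; have := allP s_sing q qs; rewrite /= !unit_rank_lt /D.
  by rewrite !unitmxE det_ublock det1 mul1r.
case/allpairsP=> [[pp bu]] [_ _ ->] /=.
rewrite ltnS /E mulmxA (leq_trans (mxrankM_maxr _ _)) //.
exact: rank_leq_row.
Qed.

Lemma step_kill (V : zmodType) k (f : 'M[F]_(1 + n, k) -> V) X :
  (\rank X < 1 + n)%N ->
  minor_comb ((c0 * (c0 *+ (#|F| ^ n)), 1%:M) :: step_tail) f X = 0.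
Proof.
move=> rX; pose f' Y := \sum_(p <- z) f (D p.2 *m Y) *~ p.1.
have -> : minor_comb ((c0 * (c0 *+ (#|F| ^ n)), 1%:M) :: step_tail) f X =
    f' X *~ (c0 *+ (#|F| ^ n)) -
    \sum_(b : 'rV[F]_n) \sum_(p <- z) (\sum_(u : 'cV[F]_n) f' (E p.2 b u *m X)) *~ p.1.
  rewrite /minor_comb /step_tail -[_ :: (_ ++ _)]cat_cons big_cat; congr (_ + _).
    rewrite big_cons big_map /f' big_cons /= mulrzDl -mulrzA /D -scalar_mx_block.
    by congr (_ + _); rewrite mulrz_suml; apply: eq_bigr => p _; rewrite -mulrzA.
  rewrite !big_allpairs_dep -sumrN.
  under eq_bigr => p _ do under eq_bigr => p' _ do
    rewrite big_enum /= -(pair_bigA _ (fun b u => f (D p'.2 *m E p.2 b u *m X) *~ - (p'.1 * p.1))) /=.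
  under eq_bigr => p _ do rewrite exchange_big /=.
  rewrite exchange_big; apply: eq_bigr => b _.
  rewrite -sumrN; apply: eq_bigr => p _.
  rewrite exchange_big /= mulrz_suml -sumrN; apply: eq_bigr => u _.
  rewrite /f' mulrz_suml -sumrN; apply: eq_bigr => p' _.
  by rewrite mulrNz -mulrzA mulmxA.
have f'0 y x : (\rank x < n)%N -> f' (col_mx y x) = 0.
  move=> rx; rewrite -[RHS](z_kill (fun Z => f (col_mx y Z)) rx).
  by apply: eq_bigr => p _; rewrite mul_block_col mul1mx !mul0mx addr0 add0r.
rewrite -[X]vsubmxK in rX *; set y := usubmx X in rX *; set x := dsubmx X in rX *.
have EX A b u : E A b u *m col_mx y x = col_mx b 1%:M *m (u *m (y - b *m x) + A *m x).
  rewrite -mulmxA mul_row_col; congr (_ *m _).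
  by rewrite mulmxBr mulmxBl !mulmxA [in RHS]addrAC addrA.
have [xn|nx] := ltnP (\rank x) n.
  rewrite f'0 // mul0rz sub0r big1 ?oppr0 // => b _.
  under eq_bigr do rewrite mulrz_suml.
  rewrite exchange_big big1 // => u _.
  rewrite -[RHS](z_kill (fun Z => f' (col_mx b 1%:M *m (u *m (y - b *m x) + Z))) xn).
  by apply: eq_bigr => p _; rewrite EX.
(* Here [x] alone already has rank [n], the largest rank possible for [X]. *)
have /submxP[c yc] : (y <= x)%MS.
  have xX : (x <= col_mx y x)%MS by rewrite -addsmxE addsmxSr.
  have : (col_mx y x <= x)%MS.
    by rewrite -(geq_leqif (mxrank_leqif_sup xX)) (leq_trans _ nx).
  by apply: submx_trans; rewrite -addsmxE addsmxSl.
(* For b = c the argument is (c A x, A x) whatever [u] is: singular A contribute zero, and the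
   [#|F| ^ n] equal terms with A = 1 cancel the multiple of f'. *)
rewrite (bigD1 c) //= [X in _ - (_ + X)]big1 ?addr0 => [|b bc].
  rewrite big_cons [X in _ - (_ + X)]big1_seq ?addr0 => [|p /andP[_ ps]] /=; last first.
    rewrite big1 ?mul0rz // => u _; rewrite EX -yc subrr mulmx0 add0r mul_col_mx mul1mx f'0 //.
    by rewrite (leq_ltn_trans (mxrankM_maxl _ _)) ?(allP s_sing).
  under eq_bigr => u _ do rewrite EX -yc subrr mulmx0 add0r mul1mx mul_col_mx mul1mx -yc.
  by rewrite sumr_const card_mx muln1 -[c0 *+ _]mulr_natl mulrzA natz -pmulrn subrr.
have cb : c - b != 0 by rewrite subr_eq0 eq_sym.
rewrite -[RHS](minor_comb_rank1_shift (fun Z => f' (col_mx b 1%:M *m (Z *m x)))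
  (@z_kill V n) cb).
apply: eq_bigr => p _; congr (_ *~ _); apply: eq_bigr => u _.
by rewrite EX {1}yc -mulmxBl [in RHS]mulmxDl -(mulmxA u) [_ *m x + _]addrC.
Qed.

End Step.

Lemma exists_left_annihilator n : exists (N : nat) (s : seq (int * 'M[F]_n)),
  all (fun p => \rank p.2 < n)%N s /\
  forall (V : zmodType) k (f : 'M[F]_(n, k) -> V) X, (\rank X < n)%N ->
    minor_comb (((#|F| ^ N)%N%:Z, 1%:M) :: s) f X = 0.
Proof.
elim: n => [|n [N [s [s_sing s_kill]]]].
  by exists 0%N, [::]; split=> // V k f X; rewrite ltn0.
(* The new leading coefficient is the old one squared, times [#|F| ^ n]. *)
exists (N + N + n)%N, (step_tail (#|F| ^ N)%N s); split.
  exact: step_tail_sing.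
move=> V k f X rX; rewrite -[RHS](step_kill s_sing s_kill f rX).
congr (minor_comb ((_, _) :: _) f X).
by rewrite !expnD !PoszM -[_ *+ _]mulr_natr natz mulrA.
Qed.

Variables (R : pzRingType) (B : lmodType R).
Hypothesis hF : invertible (#|F|%:R : R).

Lemma invertible_card_expn N : exists y : R, y * (#|F| ^ N)%:R = 1.
Proof.
have [y [yq qy]] := hF; exists (y ^+ N).
elim: N => [|N IH]; first by rewrite expr0 mul1r.
by rewrite exprS expnSr natrM mulrA -(mulrA y) IH mulr1.
Qed.

Lemma scale_card_inj N (x : B) : x *+ (#|F| ^ N) = 0 -> x = 0.
Proof.
have [y yq] := invertible_card_expn N => x0.
by rewrite -[x]scale1r -yq -scalerA scaler_nat x0 scaler0.
Qed.

(* The transpose of a left annihilator is a right annihilator, and the product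
   of the two can be evaluated in both orders, so they agree. *)
Lemma exists_annihilator n : exists (N : nat) (s : seq (int * 'M[F]_n)),
  [/\ all (fun p => \rank p.2 < n)%N s,
   forall k (f : 'M[F]_(n, k) -> B) X, (\rank X < n)%N ->
     minor_comb (((#|F| ^ N)%N%:Z, 1%:M) :: s) f X = 0 &
   forall m (f : 'M[F]_(m, n) -> B) X, (\rank X < n)%N ->
     \sum_(p <- ((#|F| ^ N)%N%:Z, 1%:M) :: s) f (X *m p.2) *~ p.1 = 0].
Proof.
have [N [s [s_sing s_kill]]] := exists_left_annihilator n.
exists N, s; split => //; first by move=> k f X; exact: s_kill.
set q := (#|F| ^ N)%N%:Z; set z := (q, 1%:M) :: s in s_kill *.
have kill_tr (g : 'M[F]_n -> B) A : (\rank A < n)%N ->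
    \sum_(p <- z) g (A *m p.2^T) *~ p.1 = 0.
  move=> rA; rewrite -mxrank_tr in rA.
  rewrite -[RHS](s_kill _ _ (fun Z => g Z^T) _ rA).
  by apply: eq_bigr => p _; rewrite trmx_mul trmxK.
have z_tr (g : 'M[F]_n -> B) :
    \sum_(p <- z) g p.2 *~ p.1 = \sum_(p <- z) g p.2^T *~ p.1.
  pose S := \sum_(p <- z) (\sum_(p' <- z) g (p.2 *m p'.2^T) *~ p'.1) *~ p.1.
  (* With [p] outside, the transposed combination kills singular [p]; with [p'] outside, [z] kills
     singular [p']. Each time only the identity term, of weight [q], survives. *)
  have S1 : S = (\sum_(p <- z) g p.2^T *~ p.1) *~ q.
    rewrite /S big_cons [X in _ + X]big1_seq ?addr0 => [|p /andP[_ ps]].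
      by under [in LHS]eq_bigr do rewrite mul1mx.
    by rewrite kill_tr ?mul0rz // (allP s_sing).
  have S2 : S = (\sum_(p <- z) g p.2 *~ p.1) *~ q.
    rewrite /S; under eq_bigr do rewrite mulrz_suml.
    rewrite exchange_big [LHS]big_cons [X in _ + X = _]big1_seq ?addr0 => [|p' /andP[_ ps]] /=.
      by rewrite mulrz_suml; apply: eq_bigr => p _; rewrite trmx1 mulmx1 -!mulrzA mulrC.
    have rp : (\rank p'.2^T < n)%N by rewrite mxrank_tr (allP s_sing).
    transitivity (minor_comb z g p'.2^T *~ p'.1); last by rewrite s_kill ?mul0rz.
    rewrite mulrz_suml.
    by apply: eq_bigr => p _; rewrite -!mulrzA mulrC.
  apply/eqP; rewrite -subr_eq0; apply/eqP; apply: (@scale_card_inj N).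
  by rewrite pmulrn mulrzBl -S1 -S2 subrr.
move=> m f X rX; rewrite (z_tr (fun A => f (X *m A))); rewrite -mxrank_tr in rX.
rewrite -[RHS](s_kill _ _ (fun Z => f Z^T) _ rX).
by apply: eq_bigr => p _; rewrite trmx_mul trmxK.
Qed.

End Annihilator.

(** * Clonoids and functions on full rank matrices *)

Section Clonoids.
Variables (F : finFieldType) (k : nat) (R : pzRingType) (B : lmodType R).

Implicit Types C D : clonoid F k B.

Lemma clonoid_mulmx C m n (f : 'M[F]_(m.+1, k) -> B) (M : 'M[F]_(m.+1, n.+1)) :
  C m f -> C n (fun X => f (M *m X)).
Proof.
move=> Cf; pose g i (x : 'I_n.+1 -> 'rV[F]_k) := \sum_l M i l *: x l.
have gt i : term_op (g i) by exists (M i).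
have := clonoid_dom C m n f g Cf gt.
congr (C n _); apply/funext => X; congr f; apply/row_matrixP => i.
by rewrite rowK row_mul mulmx_sum_row; apply: eq_bigr => l _; rewrite mxE.
Qed.

(* The operations of arity [i] of [C], with arity zero allowed: for [i = 0] they
   are the values of the constant operations in [C]. *)
Definition clonoid_part C i (f : 'M[F]_(i, k) -> B) : Prop :=
  forall n (M : 'M[F]_(i, n.+1)), C n (fun X => f (M *m X)).

Lemma clonoid_partS C i (f : 'M[F]_(i.+1, k) -> B) : clonoid_part C f <-> C i f.
Proof.
split=> [Cf|Cf n M]; last exact: clonoid_mulmx.
by have := Cf i 1%:M; congr (C i _); apply/funext => X; rewrite mul1mx.
Qed.

Lemma clonoid_part_mulmx C i l (f : 'M[F]_(i, k) -> B) (P : 'M[F]_(i, l)) :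
  clonoid_part C f -> clonoid_part C (fun X : 'M_(l, k) => f (P *m X)).
Proof.
move=> Cf n M; have := Cf n (P *m M); congr (C n _).
by apply/funext => X; rewrite mulmxA.
Qed.

Lemma clonoid_part0 C i : clonoid_part C (fun _ : 'M_(i, k) => 0).
Proof. by move=> n M; exact: clonoid0. Qed.

Lemma clonoid_partZ C i a (f : 'M[F]_(i, k) -> B) :
  clonoid_part C f -> clonoid_part C (fun X => a *: f X).
Proof.
move=> Cf n M.
apply: (clonoid_codom C n 0 (fun=> fun X => f (M *m X)) (fun x => a *: x ord0)) => //.
by exists (fun=> a) => x; rewrite big_ord1.
Qed.

Lemma clonoid_partD C i (f g : 'M[F]_(i, k) -> B) :
  clonoid_part C f -> clonoid_part C g -> clonoid_part C (fun X => f X + g X).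
Proof.
move=> Cf Cg n M.
pose fg (i : 'I_2) X := if i == ord0 then f (M *m X) else g (M *m X).
apply: (clonoid_codom C n 1 fg (fun x => x ord0 + x ord_max)).
  by move=> j; rewrite /fg; case: (j == ord0).
by exists (fun=> 1) => x; rewrite big_ord_recl big_ord1 !scale1r; congr (_ + _); congr x; exact: val_inj.
Qed.

(** For [i = 0] the only argument is the empty matrix, so a function is its value, an element of
    [B]. *)
Definition restr i : ('M[F]_(i, k) -> B) -> Mmod F k B i :=
  match i return ('M[F]_(i, k) -> B) -> Mmod F k B i with
  | 0 => fun f => f 0
  | i'.+1 => fun f X => f (sval X)
  end.

Definition ext0 i : Mmod F k B i -> 'M[F]_(i, k) -> B :=
  match i return Mmod F k B i -> 'M[F]_(i, k) -> B with
  | 0 => fun b _ => b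
  | i'.+1 => fun u X =>
      if insub X is Some Y then u (Y : {X : 'M[F]_(i'.+1, k) | \rank X == i'.+1}) else 0
  end.

Definition vanishing i (f : 'M[F]_(i, k) -> B) := forall X, (\rank X < i)%N -> f X = 0.

Lemma ext0_vanishing i (u : Mmod F k B i) : vanishing (ext0 u).
Proof. by case: i u => [|i] u X //= rX; rewrite insubF // ltn_eqF. Qed.

Lemma ext0_full i (u : Mmod F k B i.+1) (X : full_rank F k i.+1) : ext0 u (sval X) = u X.
Proof. by rewrite /= valK. Qed.

Lemma ext0K i (u : Mmod F k B i) : restr (ext0 u) = u.
Proof. by case: i u => [|i] u //; apply/funext => X; exact: ext0_full. Qed.

Lemma restrK i (f : 'M[F]_(i, k) -> B) : vanishing f -> ext0 (restr f) = f.
Proof.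
case: i f => [|i] f f0; apply/funext => X /=.
  by congr f; apply/matrixP => [[]].
case: insubP => [Y _ <- //|rX]; rewrite f0 // ltn_neqAle rX.
exact: rank_leq_row.
Qed.

Lemma ext0_0 i : ext0 (0 : Mmod F k B i) = fun=> 0.
Proof. by case: i => [|i] //; apply/funext => X /=; case: insub. Qed.

Lemma ext0B i (u v : Mmod F k B i) X : ext0 (u - v) X = ext0 u X - ext0 v X.
Proof. by case: i u v X => [|i] u v X //=; case: insub => [Y|] //; rewrite subr0. Qed.

Lemma ext0_group_ring_act i a (u : Mmod F k B i.+1) X :
  ext0 (group_ring_act a u : Mmod F k B i.+1) X =
  \sum_(M : {'GL_i.+1[F]}) a M *: ext0 u ((GLval M : 'M_i.+1) *m X).
Proof.
case: (boolP (\rank X == i.+1)) => rX.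
  rewrite -[X]/(sval (exist _ X rX : full_rank F k i.+1)) ext0_full.
  by apply: eq_bigr => M _; rewrite -(ext0_full u (GLmul M _)).
have rX' : (\rank X < i.+1)%N by rewrite ltn_neqAle rX rank_leq_row.
rewrite ext0_vanishing // big1 // => M _; rewrite ext0_vanishing ?scaler0 //.
exact: leq_ltn_trans (mxrankM_maxr _ _) rX'.
Qed.

Section SubmoduleRestr.
Variables (i : nat) (U : submodule (Mmod F k B i)).

Lemma submoduleD (u v : Mmod F k B i) : U u -> U v -> U (u + v).
Proof.
move=> Uu Uv; have : U (u - (0 - v)) by do ?apply: submoduleB => //; apply: submodule0.
by rewrite sub0r opprK.
Qed.

Lemma submodule_restr_act a (M : 'M[F]_i) f : M \in unitmx ->
  U (restr f) -> U (restr (fun X => a *: f (M *m X))).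
Proof.
case: i U M f => [|j] V M f uM /= Uf.
  by rewrite mulmx0; exact: (@submodule_act _ V (a : am_scalar (Mmod F k B 0)) _ Uf).
pose G := Sub M uM : {'GL_j.+1[F]}.
pose c : {ffun {'GL_j.+1[F]} -> R} := [ffun N => if N == G then a else 0].
have := @submodule_act _ V (c : am_scalar (Mmod F k B j.+1)) _ Uf; congr (submodule_set V _).
apply/funext => X; rewrite /= /group_ring_act (bigD1 G) //= ffunE eqxx big1 ?addr0 //.
by move=> N /negPf NG; rewrite ffunE NG scale0r.
Qed.

Lemma submodule_restrZ a f : U (restr f) -> U (restr (fun X => a *: f X)).
Proof.
move=> /(submodule_restr_act a (unitmx1 _ _)); congr (submodule_set U _); congr restr.
by apply/funext => X; rewrite mul1mx.
Qed.

Lemma submodule_restr0 : U (restr (fun=> 0)).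
Proof. by have := submodule0 U; congr (submodule_set U _); case: (i). Qed.

Lemma submodule_restrD f g :
  U (restr f) -> U (restr g) -> U (restr (fun X => f X + g X)).
Proof.
move=> Uf Ug; have := submoduleD Uf Ug; congr (submodule_set U _).
by case: (i) f g {Uf Ug}.
Qed.

Lemma submodule_restr_sum (J : Type) (r : seq J) (c : J -> R) f :
  (forall j, U (restr (f j))) -> U (restr (fun X => \sum_(j <- r) c j *: f j X)).
Proof.
move=> Uf; elim: r => [|j r IH].
  have := submodule_restr0; congr (submodule_set U (restr _)).
  by apply/funext => X; rewrite big_nil.
have := submodule_restrD (submodule_restrZ (c j) (Uf j)) IH.
by congr (submodule_set U (restr _)); apply/funext => X; rewrite big_cons.
Qed.

End SubmoduleRestr.

(** * The correspondence between clonoids and families of submodules *)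

Section Correspondence.
Hypothesis hF : invertible (#|F|%:R : R).

Let ann n := cid (exists_annihilator B hF n).
Let N n : nat := projT1 (ann n).
Let s n : seq (int * 'M[F]_n) := projT1 (cid (projT2 (ann n))).
Let z n := ((#|F| ^ N n)%N%:Z, 1%:M) :: s n.

Let s_sing n p : p \in s n -> (\rank p.2 < n)%N.
Proof. by move: p; apply/allP; case: (projT2 (cid (projT2 (ann n)))). Qed.

Let z_vanishing n f : vanishing (minor_comb (z n) f).
Proof. by case: (projT2 (cid (projT2 (ann n)))) => _ + _ X; apply. Qed.

Let z_right n m (f : 'M[F]_(m, n) -> B) X :
  (\rank X < n)%N -> \sum_(p <- z n) f (X *m p.2) *~ p.1 = 0.
Proof. by case: (projT2 (cid (projT2 (ann n)))) => _ _; apply. Qed.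

Lemma minor_combE n (f : 'M[F]_(n, k) -> B) X :
  minor_comb (z n) f X = f X *+ #|F| ^ N n + minor_comb (s n) f X.
Proof. by rewrite /minor_comb big_cons mul1mx -pmulrn. Qed.

Section MinorInduction.
(** Used for the operations of a clonoid and for the combinations of low rank minors of a fixed
    function. *)
Variable K : forall i, ('M[F]_(i, k) -> B) -> Prop.
Hypothesis K0 : forall i, K (fun _ : 'M_(i, k) => 0).
Hypothesis KD : forall i (f g : 'M_(i, k) -> B), K f -> K g -> K (fun X => f X + g X).
Hypothesis KZ : forall i a (f : 'M_(i, k) -> B), K f -> K (fun X => a *: f X).
Hypothesis KM : forall i l (f : 'M_(i, k) -> B) (P : 'M_(i, l)),
  K f -> K (fun X : 'M_(l, k) => f (P *m X)).

Lemma minor_comb_closed i (r : seq (int * 'M[F]_i)) (f : 'M_(i, k) -> B) :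
  (forall p, p \in r -> K (fun X => f (p.2 *m X))) -> K (minor_comb r f).
Proof.
elim: r => [|p r IH] Kf.
  by have := K0 i; congr K; apply/funext => X; rewrite /minor_comb big_nil.
have Kp := KZ p.1%:~R (Kf p (mem_head _ _)).
have := KD Kp (IH (fun q qr => Kf q (@mem_behead _ (p :: r) q qr))); congr K.
by apply/funext => X; rewrite /minor_comb big_cons scaler_int.
Qed.

(* Modulo minors of smaller arity an operation is a multiple of [minor_comb (z i)]
   of itself. *)
Lemma minor_induction m (f : 'M_(m, k) -> B) :
  (forall i (M : 'M_(m, i)), K (minor_comb (z i) (fun X => f (M *m X)))) -> K f.
Proof.
move=> Kz; suff KfM i (M : 'M_(m, i)) : K (fun X => f (M *m X)).
  by have := KfM m 1%:M; congr K; apply/funext => X; rewrite mul1mx.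
have [i' lei'] := ubnP i; elim: i' i lei' M => // i' IH i lei' M.
have [y yq] := invertible_card_expn hF (N i).
have Ks : K (minor_comb (s i) (fun X => f (M *m X))).
  apply: minor_comb_closed => p ps.
  have ri : (\rank p.2 < i')%N by apply: leq_trans (s_sing ps) _.
  (* A singular [p.2] factors through its rank, so this minor comes from one of smaller arity. *)
  have := KM (row_base p.2) (IH _ ri (M *m col_base p.2)); congr K.
  by apply/funext => X; rewrite [in LHS]mulmxA -(mulmxA M) mulmx_base -mulmxA.
have := KZ y (KD (Kz i M) (KZ (-1) Ks)); congr K; apply/funext => X.
by rewrite minor_combE scaleN1r addrK -scaler_nat scalerA yq scale1r.
Qed.

End MinorInduction.

Lemma clonoid_part_minor_comb C i r (f : 'M_(i, k) -> B) :
  clonoid_part C f -> clonoid_part C (minor_comb r f).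
Proof.
move=> Cf; apply: (@minor_comb_closed (@clonoid_part C)).
- exact: clonoid_part0.
- exact: clonoid_partD.
- exact: clonoid_partZ.
- by move=> p _; exact: clonoid_part_mulmx.
Qed.

Program Definition full_part C i : submodule (Mmod F k B i) :=
  @Submodule _ (fun u => clonoid_part C (ext0 u)) _ _ _.
Next Obligation. by move=> C i /=; rewrite ext0_0; exact: clonoid_part0. Qed.
Next Obligation.
move=> C i u v Cu Cv /=; have := clonoid_partD Cu (clonoid_partZ (-1) Cv).
by congr clonoid_part; apply/funext => X; rewrite ext0B scaleN1r.
Qed.
Next Obligation.
move=> C [|i] a u Cu; first exact: clonoid_partZ.
pose T (r : seq {'GL_i.+1[F]}) :=
  clonoid_part C (fun X => \sum_(M <- r) a M *: ext0 u ((GLval M : 'M_i.+1) *m X)).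
have : T (index_enum {'GL_i.+1[F]}).
  elim: (index_enum _) => [|M r IH]; rewrite /T.
    by have := @clonoid_part0 C i.+1; congr clonoid_part; apply/funext => X; rewrite big_nil.
  have := clonoid_partD (clonoid_partZ (a M) (clonoid_part_mulmx (GLval M : 'M_i.+1) Cu)) IH.
  by congr clonoid_part; apply/funext => X; rewrite big_cons.
by congr clonoid_part; apply/funext => X; rewrite -ext0_group_ring_act.
Qed.

Section GeneratedClonoid.
Variable U : forall i : 'I_k.+1, submodule (Mmod F k B i).

Definition minors_in m (f : 'M[F]_(m, k) -> B) : Prop :=
  forall (i : 'I_k.+1) (M : 'M[F]_(m, i)),
    U i (restr (minor_comb (z i) (fun X => f (M *m X)))).

Lemma minors_in_lin m n (c : 'I_n -> R) (f : 'I_n -> 'M[F]_(m, k) -> B) :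
  (forall j, minors_in (f j)) -> minors_in (fun X => \sum_j c j *: f j X).
Proof.
move=> Uf i M; have := submodule_restr_sum (index_enum 'I_n) c (fun j => Uf j i M).
congr (submodule_set (U i) (restr _)); apply/funext => X; rewrite /minor_comb.
under eq_bigr do rewrite scaler_sumr.
rewrite exchange_big; apply: eq_bigr => p _; rewrite mulrz_suml.
by apply: eq_bigr => j _; rewrite scalerMzr.
Qed.

Lemma minors_in_mulmx m n (P : 'M[F]_(m, n)) (f : 'M[F]_(m, k) -> B) :
  minors_in f -> minors_in (fun X : 'M_(n, k) => f (P *m X)).
Proof.
move=> Uf i M; have := Uf i (P *m M); congr (submodule_set (U i) (restr _)).
by apply/funext => X; apply: eq_bigr => p _; rewrite !mulmxA.
Qed.

Program Definition gen_clonoid : clonoid F k B :=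
  @Clonoid F k R B (fun m f => minors_in f) _ _ _.
Next Obligation.
exists 0%N, (fun=> 0) => i M; have := submodule_restr0 (U i).
congr (submodule_set (U i) (restr _)); apply/funext => X.
by rewrite /minor_comb big1 // => p _; rewrite mul0rz.
Qed.
Next Obligation.
move=> m n f g Uf [c gc]; have := minors_in_lin c Uf.
by congr minors_in; apply/funext => X; rewrite gc.
Qed.
Next Obligation.
move=> m n f g Uf gt; have [c gc] := choice gt.
have := minors_in_mulmx (\matrix_(i, l) c i l) Uf; congr minors_in.
apply/funext => X; congr f; apply/row_matrixP => i.
rewrite rowK gc row_mul mulmx_sum_row; apply: eq_bigr => l _.
by rewrite !mxE.
Qed.

Lemma gen_clonoid_part m (f : 'M[F]_(m, k) -> B) :
  clonoid_part gen_clonoid f <-> minors_in f.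
Proof.
split=> [Uf|Uf n M]; last exact: minors_in_mulmx.
(* A dummy first row makes the arity positive even for [m = 0]; setting it to zero recovers [f]. *)
pose P : 'M[F]_(m, 1 + m) := row_mx 0 1%:M.
have UP : minors_in (fun X : 'M_(1 + m, k) => f (P *m X)) by exact: Uf m P.
have := minors_in_mulmx (col_mx 0 1%:M) UP; congr minors_in.
by apply/funext => X; rewrite mulmxA mul_row_col mulmx0 add0r !mul1mx.
Qed.

(** Singular matrices push the argument below full rank, where an extension by zero vanishes; only
    the identity term remains. *)
Let minor_comb_ext0 i (u : Mmod F k B i) (P : 'M[F]_i) X :
  minor_comb (z i) (fun X => ext0 u (P *m X)) X = (#|F| ^ N i)%:R *: ext0 u (P *m X).
Proof.
rewrite minor_combE scaler_nat /minor_comb big1_seq ?addr0 // => p /andP[_ ps].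
rewrite ext0_vanishing ?mul0rz // (leq_ltn_trans (mxrankM_maxr _ _)) //.
by rewrite (leq_ltn_trans (mxrankM_maxl _ _)) ?s_sing.
Qed.

Lemma full_part_gen_clonoid (i : 'I_k.+1) : full_part gen_clonoid i = U i.
Proof.
apply: submodule_eq => u; split=> [/gen_clonoid_part Uu|Uu].
  have [y yq] := invertible_card_expn hF (N i).
  suff: U i (restr (ext0 u)) by rewrite ext0K.
  have := submodule_restrZ y (Uu i 1%:M).
  congr (submodule_set (U i) (restr _)); apply/funext => X.
  by rewrite minor_comb_ext0 scalerA yq scale1r mul1mx.
apply/gen_clonoid_part => j P.
have zero : (forall X, minor_comb (z j) (fun X => ext0 u (P *m X)) X = 0) ->
    U j (restr (minor_comb (z j) (fun X => ext0 u (P *m X)))).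
  by move=> h0; rewrite (funext h0); exact: submodule_restr0.
(* If [P] has rank below [j], annihilation from the right applies; if [j < i], no [P X] has full
   rank. Otherwise [i = j] and [P] is invertible, so the group action on [U] applies. *)
have [Pj|jP] := ltnP (\rank P) j.
  apply: zero => X; rewrite -[RHS](z_right (fun Z => ext0 u (Z *m X)) Pj).
  by apply: eq_bigr => p _; rewrite mulmxA.
have [ji|ij] := ltnP j i.
  apply: zero => X; rewrite /minor_comb big1 // => p _; rewrite ext0_vanishing ?mul0rz //.
  apply: leq_ltn_trans (mxrankM_maxl _ _) _.
  exact: leq_ltn_trans (rank_leq_col _) ji.
have eij : i = j.
  by apply/val_inj/eqP; rewrite eqn_leq ij (leq_trans jP) ?rank_leq_row.
case: _ / eij P jP {zero ij} => P iP.
have uP : P \in unitmx by rewrite -row_full_unit /row_full eqn_leq rank_leq_col.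
rewrite (funext (minor_comb_ext0 u P)); apply: submodule_restr_act => //.
by rewrite ext0K.
Qed.

End GeneratedClonoid.

Lemma vanishing_gt_width i (f : 'M[F]_(i, k) -> B) : (k < i)%N -> vanishing f -> f = fun=> 0.
Proof.
by move=> ki f0; apply/funext => X; rewrite f0 // (leq_ltn_trans (rank_leq_col _)).
Qed.

(** Since [minor_comb (z i)] yields functions supported on full rank, [ext0] undoes [restr] on them,
    and [minor_induction] rebuilds [f] from them. *)
Lemma gen_clonoid_full_part C : gen_clonoid (fun i => full_part C i) = C.
Proof.
apply: clonoid_eq => m f; split=> [Uf|/clonoid_partS Cf].
  apply/clonoid_partS; apply: (@minor_induction (@clonoid_part C)).
  - exact: clonoid_part0.
  - exact: clonoid_partD.
  - exact: clonoid_partZ.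
  - exact: clonoid_part_mulmx.
  move=> i M; have [ik|ki] := ltnP i k.+1.
    by have := Uf (Ordinal ik) M; rewrite /= restrK.
  by rewrite (vanishing_gt_width ki (@z_vanishing _ _)); exact: clonoid_part0.
move=> i M /=; rewrite restrK //.
by apply: clonoid_part_minor_comb; exact: clonoid_part_mulmx.
Qed.

(** Lists are easily concatenated, as closure under sums requires. *)
Lemma gen_by_minorsP m j (f : 'M[F]_(m, k) -> B) : gen_by_minors j f <->
  exists r : seq (R * 'M[F]_m), (forall p, p \in r -> (\rank p.2 <= j)%N) /\
    forall X, f X = \sum_(p <- r) p.1 *: f (p.2 *m X).
Proof.
split=> [[n [M [a [rM fE]]]]|[r [rr fE]]].
  exists [seq (a t, M t) | t <- enum 'I_n]; split=> [p /mapP[t _ ->]|X].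
    exact: rM.
  by rewrite big_map big_enum fE.
exists (size r), (fun t => (tnth (in_tuple r) t).2), (fun t => (tnth (in_tuple r) t).1).
by split=> [t|X]; [exact/rr/mem_tnth|rewrite fE big_tnth].
Qed.

(** By [minor_induction] it suffices to treat [z i] applied to minors: for [i <= j] these are low
    rank combinations, for [i > j] they vanish. Conversely, a function supported on rank [i > j] has
    only zero minors through rank at most [j]. *)
Lemma full_part_zeroP C j :
  (forall i : 'I_k.+1, (j < i)%N -> is_zero_submodule (full_part C i)) <->
  (forall m (f : 'M[F]_(m.+1, k) -> B), C m f -> gen_by_minors j f).
Proof.
split=> [U0 m f Cf|Cj [[|i] lti] // ji u]; last first.
  split=> [/clonoid_partS /Cj [n [M [a [rM uE]]]]|->]; last exact: submodule0.
  rewrite -[u]ext0K; apply/funext => X /=; rewrite -/(ext0 u) -[RHS]/0.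
  rewrite [LHS]uE big1 // => t _; rewrite [ext0 u _]ext0_vanishing ?scaler0 //.
  exact: leq_ltn_trans (mxrankM_maxl _ _) (leq_ltn_trans (rM t) ji).
apply/gen_by_minorsP.
pose K i (g : 'M[F]_(i, k) -> B) := exists r : seq (R * 'M[F]_(m.+1, i)),
  (forall p, p \in r -> (\rank p.2 <= j)%N) /\
  forall X, g X = \sum_(p <- r) p.1 *: f (p.2 *m X).
have K0 i : K i (fun=> 0) by exists [::]; split=> // X; rewrite big_nil.
have KD i g h : K i g -> K i h -> K i (fun X => g X + h X).
  move=> [r [rr gE]] [r' [rr' hE]]; exists (r ++ r'); split=> [p|X].
    by rewrite mem_cat => /orP[/rr|/rr'].
  by rewrite big_cat gE hE.
have KZ i a g : K i g -> K i (fun X => a *: g X).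
  move=> [r [rr gE]]; exists [seq (a * p.1, p.2) | p <- r]; split=> [p /mapP[q /rr + ->] //|X].
  by rewrite big_map gE scaler_sumr; apply: eq_bigr => p _; rewrite scalerA.
have KM i l g (P : 'M_(i, l)) : K i g -> K l (fun X => g (P *m X)).
  move=> [r [rr gE]]; exists [seq (p.1, p.2 *m P) | p <- r]; split=> [p /mapP[q /rr + ->]|X].
    by apply: leq_trans; exact: mxrankM_maxl.
  by rewrite big_map gE; apply: eq_bigr => p _; rewrite mulmxA.
apply: (@minor_induction K) => // i M.
have [ij|ji] := leqP i j.
  apply: (@minor_comb_closed K) => // p _; exists [:: (1, M *m p.2)]; split=> [q|X].
    by rewrite inE => /eqP -> /=; apply: leq_trans (rank_leq_col _) ij.
  by rewrite big_seq1 scale1r mulmxA.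
suff -> : minor_comb (z i) (fun X => f (M *m X)) = fun=> 0 by exact: K0.
have [ik|ki] := ltnP i k.+1; last exact: vanishing_gt_width.
rewrite -[LHS]restrK // -ext0_0; congr ext0; apply/(U0 (Ordinal ik) ji) => /=.
rewrite restrK //; apply: clonoid_part_minor_comb; apply: clonoid_part_mulmx.
exact/clonoid_partS.
Qed.

Lemma full_part_mono C D i : (C <= D)%O -> (full_part C i <= full_part D i)%O.
Proof.
by move=> /clonoid_leP CD; apply/submodule_leP => u Cu n M; exact/CD/Cu.
Qed.

Lemma gen_clonoid_mono (U V : forall i : 'I_k.+1, submodule (Mmod F k B i)) :
  (forall i, (U i <= V i)%O) -> (gen_clonoid U <= gen_clonoid V)%O.
Proof.
move=> UV; apply/clonoid_leP => m f Uf i M.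
by have /submodule_leP := UV i; apply; exact: Uf.
Qed.

End Correspondence.
End Clonoids.

(** * Order isomorphisms preserve meets and joins *)

Section OrderIso.
Variables (d d' : Order.disp_t) (L : latticeType d) (L' : latticeType d').
Variables (phi : L -> L') (psi : L' -> L).
Hypothesis psiK : cancel psi phi.
Hypothesis phi_le : {mono phi : x y / (x <= y)%O}.

Lemma order_iso_meet : {morph phi : x y / (x `&` y)%O}.
Proof.
move=> x y; apply/le_anti; rewrite lexI !phi_le leIl leIr /=.
by rewrite -[X in (X <= _)%O]psiK phi_le lexI -!phi_le !psiK leIl leIr.
Qed.

Lemma order_iso_join : {morph phi : x y / (x `|` y)%O}.
Proof.
move=> x y; apply/le_anti; rewrite leUx !phi_le leUl leUr andbT.
by rewrite -[X in (_ <= X)%O]psiK phi_le leUx -!phi_le !psiK leUl leUr.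
Qed.

End OrderIso.

Theorem theorem55 (F : finFieldType) (k : nat) (R : pzRingType)
    (B : lmodType R) (hk : (0 < k)%N) (hF : invertible (#|F|%:R : R)) :
  exists phi : clonoid F k B -> prod_lattice (fun i : 'I_k.+1 => Msub F k B i),
    [/\ bijective phi,
        {morph phi : C D / (C `&` D)%O},
        {morph phi : C D / (C `|` D)%O} &
        forall (j : nat), (j <= k)%N -> forall C : clonoid F k B,
          (forall i : 'I_k.+1, (j < i)%N -> is_zero_submodule (phi C i)) <->
          (forall (m : nat) (f : 'M[F]_(m.+1, k) -> B),
             C m f -> gen_by_minors j f)].
Proof.
pose phi C : prod_lattice (fun i : 'I_k.+1 => Msub F k B i) := fun i => full_part C i.
pose psi (U : prod_lattice (fun i : 'I_k.+1 => Msub F k B i)) : clonoid F k B :=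
  gen_clonoid hF U.
have phiK : cancel phi psi by move=> C; exact: gen_clonoid_full_part.
have psiK : cancel psi phi.
  by move=> U; apply: functional_extensionality_dep => i; exact: full_part_gen_clonoid.
have phi_le : {mono phi : C D / (C <= D)%O}.
  move=> C D; apply/idP/idP => [/prod_leP CD|CD].
    by rewrite -[C]phiK -[D]phiK; exact: gen_clonoid_mono.
  by apply/prod_leP => i; exact: full_part_mono.
exists phi; split.
- by exists psi.
- exact: order_iso_meet psiK phi_le.
- exact: order_iso_join psiK phi_le.
- by move=> j _ C; exact: full_part_zeroP.
Qed.
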